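(* For positive integers $n_1,\ldots,n_{d+1}$, $$F_{(n_1,\ldots,n_{d+1})} = \sum_{\alpha^{(1)}, \ldots, \alpha^{(d)}} m^{(n_{d+1})}_{\alpha^{(1)},\ldots,\alpha^{(d)}}\, M_{\alpha^{(1)}}(\mathbf{x}^{(1)}) \cdots M_{\alpha^{(d)}}(\mathbf{x}^{(d)}),$$ where the sum runs over compositions $\alpha^{(1)},\ldots,\alpha^{(d)}$ with $|\alpha^{(i)}|=|\alpha^{(j)}|$ for all $i,j$, and $m^{(n_{d+1})}_{\alpha^{(1)},\ldots,\alpha^{(d)}}$ is the number of packed matrices $A\in\mathcal{M}([n_1]\times\cdots\times[n_d],n_{d+1})$ with $s_\ell(A)=\alpha^{(\ell)}$ for all $\ell\in[d]$.
   Context: A $d$-dimensional partition is an array $\pi=(\pi_{\mathbf{i}})_{\mathbf{i}\in\mathbb{Z}_+^d}$ of nonnegative integers with finitely many nonzero entries, weakly decreasing in each coordinate; $D(\pi)=\{(\mathbf{i},i)\in\mathbb{Z}_+^{d+1}:1\le i\le\pi_{\mathbf{i}}\}$; $\mathcal{P}(n_1,\ldots,n_{d+1})$ is the set of those with $D(\pi)\subseteq[n_1]\times\cdots\times[n_{d+1}]$; $\mathrm{Cor}(\pi)=\{\mathbf{i}\in D(\pi):\mathbf{i}+\mathbf{e}_\ell\notin D(\pi)\ \forall\ell\in[d]\}$. With variables $\mathbf{x}^{(k)}=(x^{(k)}_1,\ldots,x^{(k)}_{n_k})$, $F_{(n_1,\ldots,n_{d+1})}=\sum_{\pi\in\mathcal{P}(n_1,\ldots,n_{d+1})}\prod_{(i_1,\ldots,i_{d+1})\in\mathrm{Cor}(\pi)}x^{(1)}_{i_1}\cdots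 x^{(d)}_{i_d}$. For an array $A=(a_{\mathbf{i}})$ of nonnegative integers indexed by $\mathbb{Z}_+^d$ with finitely many nonzero entries, let $G_{1,\ldots,1}(A)$ be the maximum of $\sum_{\mathbf{j}\in\Pi}a_{\mathbf{j}}$ over directed lattice paths $\Pi$ (steps $\mathbf{i}\to\mathbf{i}+\mathbf{e}_\ell$) starting at $(1,\ldots,1)$; $\mathcal{M}([n_1]\times\cdots\times[n_d],n_{d+1})$ is the set of such $A$ supported in $[n_1]\times\cdots\times[n_d]$ with $G_{1,\ldots,1}(A)\le n_{d+1}$. For $\ell\in[d]$ and $i\in[n_\ell]$, let $B^{(\ell)}_i$ be the sum of entries $a_{i_1,\ldots,i_d}$ with $i_\ell=i$, and $s_\ell(A)=(B^{(\ell)}_1,\ldots,B^{(\ell)}_{n_\ell})$; $A$ is packed if each $s_\ell(A)$ has no zero entries between positive entries; the equality $s_\ell(A)=\alpha^{(\ell)}$ is understood after deleting trailing zeros. For a composition $\alpha=(\alpha_1,\ldots,\alpha_k)\in\mathbb{Z}_+^k$, $M_\alpha(y_1,\ldots,y_n)=\sum_{i_1<\cdots<i_k}y_{i_1}^{\alpha_1}\cdots y_{i_k}^{\alpha_k}$ (zero if $k>n$), and $|\alpha|=\sum\alpha_i$. *)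

(* Defs.v *)
From HB Require Import structures.
From mathcomp Require Import all_boot all_order all_algebra finmap.
From mathcomp Require Import boolp classical_sets functions cardinality fsbigop.
From mathcomp Require Import monalg.

Set Implicit Arguments.
Unset Strict Implicit.
Unset Printing Implicit Defensive.

Import Order.TTheory GRing.Theory Num.Theory.

Local Open Scope classical_set_scope.
Local Open Scope ring_scope.

(* All coordinates are shifted down by one: the natural number i stands for
   the positive integer i + 1, so that idx d is Z_+^d, [n] is {i | i < n} and
   the point (1, ..., 1) is the zero function. *)
Definition idx (d : nat) : choiceType := {ffun 'I_d -> nat}.

Definition array (d : nat) : choiceType := {fsfun idx d -> nat with 0%N}.

Definition idx1 (d : nat) : idx d := [ffun=> 0%N].

Definition shift (d : nat) (i : idx d) (l : 'I_d) : idx d :=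
  [ffun k => (i k + (k == l))%N].

Definition in_box (d : nat) (n : 'I_d -> nat) (i : idx d) : Prop :=
  forall l, (i l < n l)%N.

Definition is_partition (d : nat) (pi : array d) : Prop :=
  forall (i : idx d) (l : 'I_d), (pi (shift i l) <= pi i)%N.

(* Z_+^(d+1) is represented as the product Z_+^d x Z_+. *)
Definition diagram (d : nat) (pi : array d) : {fset (idx d * nat)} :=
  [fset c | c in [seq (i, k) | i <- finsupp pi, k <- iota 0 (pi i)]]%fset.

Lemma in_diagram (d : nat) (pi : array d) (i : idx d) (k : nat) :
  ((i, k) \in diagram pi) = (k < pi i)%N.
Proof.
apply/idP/idP.
  by rewrite !inE => /allpairsPdep[j [m [_]]]; rewrite mem_iota => h [-> ->].
move=> ki; rewrite !inE; apply/allpairsPdep; exists i, k; split=> //.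
  by rewrite mem_finsupp -lt0n; case: (pi i) ki.
by rewrite mem_iota.
Qed.

Definition partitions (d : nat) (n : 'I_d -> nat) (N : nat) : set (array d) :=
  [set pi | is_partition pi /\
            forall c, c \in diagram pi -> in_box n c.1 /\ (c.2 < N)%N].

(* Only the first d of the d + 1 directions are tested. *)
Definition corners (d : nat) (pi : array d) : {fset (idx d * nat)} :=
  [fset c in diagram pi |
     [forall l : 'I_d, (shift c.1 l, c.2) \notin diagram pi]]%fset.

(* The polynomial ring over the integers in the variables x^(l)_i. *)
Definition polyring (d : nat) : comNzRingType :=
  {malg int[{cmonom ('I_d * nat)%type}]}.

Definition xvar (d : nat) (l : 'I_d) (i : nat) : polyring d :=
  << ucm (l, i) >>.

Definition Fpoly (d : nat) (n : 'I_d -> nat) (N : nat) : polyring d :=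
  \sum_(pi \in partitions n N)
    \prod_(c <- corners pi) \prod_(l < d) xvar l (c.1 l).

Definition step (d : nat) : rel (idx d) :=
  [rel i j | [exists l : 'I_d, j == shift i l]].

(* A path starting at (1, ..., 1) is idx1 d :: p with p as below. *)
Definition path_weights (d : nat) (A : array d) : set nat :=
  [set w | exists2 p : seq (idx d),
             path (@step d) (idx1 d) p & w = (\sum_(j <- idx1 d :: p) A j)%N].

Definition is_maximum (W : set nat) (g : nat) : Prop :=
  W g /\ forall w, W w -> (w <= g)%N.

(* The default value 0 is never used, see last_passageP. *)
Definition last_passage (d : nat) (A : array d) : nat :=
  xget 0%N [set g | is_maximum (path_weights A) g].

Definition arrays_le (d : nat) (n : 'I_d -> nat) (N : nat) : set (array d) :=
  [set A : array d | (forall i, A i != 0%N -> in_box n i) /\ (last_passage A <= N)%N].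

Definition slice_sum (d : nat) (A : array d) (l : 'I_d) (i : nat) : nat :=
  (\sum_(j <- finsupp A | (j : idx d) l == i) A j)%N.

Definition slice_sums (d : nat) (n : 'I_d -> nat) (A : array d) (l : 'I_d) :
    seq nat :=
  mkseq (slice_sum A l) (n l).

Definition no_internal_zero (s : seq nat) : Prop :=
  forall i j k, (i < j < k)%N -> (0 < nth 0 s i)%N -> (0 < nth 0 s k)%N ->
    (0 < nth 0 s j)%N.

Definition packed (d : nat) (n : 'I_d -> nat) (A : array d) : Prop :=
  forall l, no_internal_zero (slice_sums n A l).

Definition delete_trailing_zeros (s : seq nat) : seq nat :=
  rev (drop (find (predC1 0%N) (rev s)) (rev s)).

Definition is_composition (a : seq nat) : bool := all (ltn 0) a.

(* A family alpha^(1), ..., alpha^(d) of compositions of equal size; the empty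
   composition is allowed. *)
Definition composition_families (d : nat) : set {ffun 'I_d -> seq nat} :=
  [set alpha | (forall l, is_composition (alpha l)) /\
               forall k l, sumn (alpha k) = sumn (alpha l)].
Arguments composition_families : clear implicits.

Definition packed_arrays (d : nat) (n : 'I_d -> nat) (N : nat)
    (alpha : {ffun 'I_d -> seq nat}) : set (array d) :=
  [set A | [/\ arrays_le n N A, packed n A &
            forall l, delete_trailing_zeros (slice_sums n A l) = alpha l]].

Definition mcoef (d : nat) (n : 'I_d -> nat) (N : nat)
    (alpha : {ffun 'I_d -> seq nat}) : nat :=
  #|` fset_set (packed_arrays n N alpha)|%fset.

Definition monomial_qsym (R : comNzRingType) (a : seq nat) (n : nat)
    (y : nat -> R) : R :=
  \sum_(f : {ffun 'I_(size a) -> 'I_n} |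
          [forall p : 'I_(size a), forall q : 'I_(size a), (p < q)%N ==> (f p < f q)%N])
     \prod_(p < size a) y (f p) ^+ nth 0%N a p.

(* Well-definedness of the maximum, of the cardinals and of the finitely
   supported sums above. *)
Definition height (d : nat) (i : idx d) : nat := (\sum_(l < d) i l)%N.

Lemma height_shift (d : nat) (i : idx d) (l : 'I_d) : height (shift i l) = (height i).+1.
Proof.
rewrite /height (eq_bigr (fun k => i k + (k == l))%N); last first.
  by move=> k _; rewrite ffunE.
rewrite big_split /= (bigD1 l) //= [X in (_ + X)%N](bigD1 l) //= eqxx.
by rewrite [X in (1 + X)%N]big1 ?addn0 ?addn1// => k /negPf ->.
Qed.

Lemma step_path_uniq (d : nat) (i : idx d) (p : seq (idx d)) : path (@step d) i p -> uniq (i :: p).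
Proof.
move=> h; have : sorted ltn (map (@height d) (i :: p)).
  rewrite /= path_map; apply: sub_path h => {}i j /= /existsP[l /eqP ->].
  by rewrite height_shift.
by move/(sorted_uniq ltn_trans ltnn)/map_uniq.
Qed.

Lemma path_weight_bound (d : nat) (A : array d) (w : nat) : path_weights A w ->
  (w <= \sum_(j <- finsupp A) A j)%N.
Proof.
move=> [p /step_path_uniq u ->]; set s := _ :: _ in u *.
rewrite (bigID (mem (finsupp A))) /= addnC big1 ?add0n; last first.
  by move=> j; rewrite memNfinsupp => /eqP.
rewrite -big_filter; set t := filter _ _.
have ut : uniq t by rewrite filter_uniq.
have st : {subset t <= finsupp A} by move=> j; rewrite mem_filter => /andP[].
rewrite [leqRHS](bigID (mem t)) /=; apply: leq_trans (leq_addr _ _).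
rewrite -[leqRHS]big_filter (perm_big [seq x <- finsupp A | x \in t])//.
apply: uniq_perm => //; first by rewrite filter_uniq// fset_uniq.
by move=> x; rewrite [in RHS]mem_filter; case: (boolP (x \in t)) => // /st ->.
Qed.

Lemma last_passageP (d : nat) (A : array d) : is_maximum (path_weights A) (last_passage A).
Proof.
rewrite /last_passage; case: xgetP => [g _ //|H]; exfalso.
pose P g := `[< path_weights A g >].
have exP : exists g, P g.
  by exists (\sum_(j <- [:: idx1 d]) A j)%N; apply/asboolP; exists [::].
have ubP g : P g -> (g <= \sum_(j <- finsupp A) A j)%N.
  by move/asboolP/path_weight_bound.
case: (ex_maxnP exP ubP) => g /asboolP Pg gmax.
by apply: (H g); split=> // w Pw; apply: gmax; apply/asboolP.
Qed.

Lemma path_to (d : nat) (i : idx d) :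
  exists2 p, path (@step d) (idx1 d) p & last (idx1 d) p = i.
Proof.
move: {2}(height i) (erefl (height i)) => h.
elim: h i => [|h IH] i hi.
  exists [::] => //=; apply/ffunP => l; rewrite ffunE; apply/esym/eqP.
  by rewrite -leqn0 -hi /height (bigD1 l) //= leq_addr.
have [l il] : exists l, (0 < i l)%N.
  apply/not_existsP => H; move: hi; rewrite /height big1// => l _.
  by apply/eqP; rewrite -leqn0 leqNgt; apply/negP; exact: H.
pose j : idx d := [ffun k => (i k - (k == l))%N].
have ij : i = shift j l.
  by apply/ffunP => k; rewrite !ffunE; case: eqVneq => [->|_];
    rewrite ?subnK// subn0 addn0.
have [p pp lp] : exists2 p, path (@step d) (idx1 d) p & last (idx1 d) p = j.
  by apply: IH; apply: succn_inj; rewrite -hi ij height_shift.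
exists (rcons p i); last by rewrite last_rcons.
by rewrite rcons_path pp lp /=; apply/existsP; exists l; rewrite ij.
Qed.

Lemma entry_le_last_passage (d : nat) (A : array d) (i : idx d) :
  (A i <= last_passage A)%N.
Proof.
have [_ ub] := last_passageP A; have [p pp lp] := path_to i.
apply: leq_trans (ub _ (ex_intro2 _ _ p pp erefl)).
have : i \in idx1 d :: p by rewrite -lp mem_last.
by move=> ip; rewrite (big_rem i)//= leq_addr.
Qed.

Lemma finite_bounded_arrays (d : nat) (n : 'I_d -> nat) (N : nat) :
  finite_set [set A : array d | (forall i, A i != 0%N -> in_box n i) /\
                                forall i, (A i <= N)%N].
Proof.
set S := [set A : array d | _]; pose m := \max_(l < d) n l.
pose r (A : array d) : {ffun {ffun 'I_d -> 'I_m.+1} -> 'I_N.+1} :=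
  [ffun c : {ffun 'I_d -> 'I_m.+1} => inord (A [ffun l => val (c l)])].
have rinj A B : S A -> S B -> r A = r B -> A = B.
  move=> [sA bA] [sB bB] rAB; apply/fsfunP => i.
  have [ib|nib] := pselect (in_box n i); last first.
    by rewrite (eqP (contra_notT (sA i) nib)) (eqP (contra_notT (sB i) nib)).
  have im l : (i l < m.+1)%N.
    by rewrite ltnS (leq_trans (ltnW (ib l)))// /m leq_bigmax.
  have := congr1 (fun f : {ffun _ -> 'I_N.+1} =>
    val (f [ffun l => Ordinal (im l)])) rAB.
  rewrite /r !ffunE /=.
  have -> : [ffun l => val ([ffun l0 => Ordinal (im l0)] l)] = i.
    by apply/ffunP => l; rewrite !ffunE.
  by rewrite !inordK ?ltnS.
rewrite -(eq_finite_set (@inj_card_eq _ _ S r _)); first exact: finite_finset.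
by move=> A B; rewrite !inE; exact: rinj.
Qed.

Lemma finite_arrays_le (d : nat) (n : 'I_d -> nat) (N : nat) :
  finite_set (arrays_le n N).
Proof.
apply: sub_finite_set (finite_bounded_arrays n N) => A [sA gA]; split=> // i.
exact: leq_trans (entry_le_last_passage A i) gA.
Qed.

Lemma finite_partitions (d : nat) (n : 'I_d -> nat) (N : nat) :
  finite_set (partitions n N).
Proof.
apply: sub_finite_set (finite_bounded_arrays n N) => A [_ sA]; split=> i.
  by rewrite -lt0n -in_diagram => /sA[].
case E : (A i) => [//|k].
by have /sA[] : (i, k) \in diagram A by rewrite in_diagram E.
Qed.

Lemma finite_packed_arrays (d : nat) (n : 'I_d -> nat) (N : nat)
    (alpha : {ffun 'I_d -> seq nat}) : finite_set (packed_arrays n N alpha).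
Proof. by apply: sub_finite_set (finite_arrays_le n N) => A []. Qed.

Lemma finite_mcoef_support (d : nat) (n : 'I_d -> nat) (N : nat) :
  finite_set [set alpha | mcoef n N alpha != 0%N].
Proof.
pose s (A : array d) :=
  [ffun l : 'I_d => delete_trailing_zeros (slice_sums n A l)].
apply: sub_finite_set (finite_image s (finite_arrays_le n N)) => alpha /=.
rewrite /mcoef cardfs_eq0 => /fset0Pn[A].
rewrite in_fset_set; last exact: finite_packed_arrays.
rewrite inE => -[MA _ sA]; exists A => //.
by apply/ffunP => l; rewrite ffunE.
Qed.

(* Main.v *)
(* A partition pi is determined by the array A of its increments
   A_i = pi_i - max_l pi_(i+e_l): conversely pi_i is the last passage time of A
   from i, and A_i is the number of corners of pi above i. Hence F is the sum
   over A in M([n_1] x ... x [n_d], n_(d+1)) of the monomials with exponents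
   s_l(A) in the variables x^(l).

   Last passage times are maxima of sums over chains of the product order, so
   they do not change when zero slices are inserted or deleted. Thus the number
   of arrays A with s_l(A) = b^(l) for all l depends only on the nonzero entries
   alpha^(l) of b^(l), and equals the number of packed ones. As M_alpha is the
   sum of the monomials y^b over the b with nonzero entries alpha, summing over
   the families b gives the expansion. *)

Require Import Defs.
From mathcomp Require Import all_boot all_order all_algebra finmap.
From mathcomp Require Import boolp classical_sets functions cardinality fsbigop.

Set Implicit Arguments.
Unset Strict Implicit.
Unset Printing Implicit Defensive.

Import GRing.Theory.

Local Open Scope classical_set_scope.
Local Open Scope ring_scope.

(** * Finitely supported big operators *)

Lemma partition_fsbig (R : Type) (neutral : R) (op : Monoid.com_law neutral)
    (I J : choiceType) (h : I -> J) (A : set I) (B : set J) (F : I -> R) :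
  finite_set A -> h @` A `<=` B ->
  \big[op/neutral]_(i \in A) F i =
  \big[op/neutral]_(j \in B) \big[op/neutral]_(i \in A `&` h @^-1` [set j]) F i.
Proof.
move=> finA hAB; rewrite -(fsbig_widen (h @` A) B)//; last first.
  move=> j [_ nhAj]; rewrite /= fsbig1// => i [Ai hij].
  by exfalso; apply: nhAj; exists i.
under [RHS]eq_fsbigr => j _ do rewrite fsbig_mkcondr.
rewrite [RHS]exchange_fsbig//; last exact: finite_image.
apply: eq_fsbigr => i; rewrite inE => Ai.
rewrite (fsbigD1 (h i)) /=; [|exact: finite_image|by exists i].
rewrite mem_set// fsbig1 ?Monoid.mulm1// => j [_ /= /nesym hij].
by rewrite memNset.
Qed.
Arguments partition_fsbig {R neutral op I J} h {A} B {F}.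

Lemma fsbig_fin (R : Type) (neutral : R) (op : Monoid.com_law neutral)
    (I : finType) (P : pred I) (F : I -> R) :
  \big[op/neutral]_(i | P i) F i = \big[op/neutral]_(i \in [set` P]) F i.
Proof. by apply: bigfs => [|i _]; rewrite ?index_enum_uniq ?mem_index_enum. Qed.

Lemma sum_fsbig_const (V : nmodType) (I : choiceType) (A : set I) (x : V) :
  finite_set A -> \sum_(i \in A) x = x *+ #|` fset_set A|.
Proof.
by move=> finA; rewrite fsbig_finite// big_const_seq count_predT iter_addr_0.
Qed.

Definition set_family (I : finType) (T : choiceType) (X : I -> set T) :
    set {ffun I -> T} := [set f | forall i, X i (f i)].

Section FiniteSetFamily.
Variables (I : finType) (T : choiceType) (X : I -> set T).
Hypothesis finite_X : forall i, finite_set (X i).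

Let U : {fset T} :=
  [fset x in flatten [seq enum_fset (fset_set (X i)) | i <- enum I]]%fset.

Let X_sub_U i x : X i x -> x \in U.
Proof.
move=> Xx; rewrite inE; apply/flatten_mapP; exists i; first by rewrite mem_enum.
by rewrite in_fset_set// inE.
Qed.

Let family_bij :
  set_bij [set` family (fun i => [pred u : U | val u \in X i])] (set_family X)
    (fun g => [ffun i => val (g i)]).
Proof.
split=> [g /familyP gX i|g h _ _ /ffunP gh|f fX].
- by have := gX i; rewrite ffunE !inE.
- by apply/ffunP => i; apply: val_inj; have := gh i; rewrite !ffunE.
exists [ffun i => [` X_sub_U (fX i)]%fset]; last first.
  by apply/ffunP => i; rewrite !ffunE.
by apply/familyP => i; rewrite ffunE !inE.
Qed.

Lemma finite_set_family : finite_set (set_family X).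
Proof.
have [_ _ surj] := family_bij; apply: sub_finite_set surj _.
exact/finite_image/finite_finset.
Qed.

Lemma bigA_distr_fsbig (R : comPzSemiRingType) (F : I -> T -> R) :
  \prod_i \sum_(x \in X i) F i x = \sum_(f \in set_family X) \prod_i F i (f i).
Proof.
rewrite (reindex_fsbig _ _ _ _ family_bij) -fsbig_fin.
transitivity (\prod_i \sum_(u : U | val u \in X i) F i (val u)); last first.
  rewrite bigA_distr_big_dep; apply: eq_bigr => g _.
  by apply: eq_bigr => i _; rewrite ffunE.
apply: eq_bigr => i _; rewrite fsbig_fin; apply: reindex_fsbig.
split=> [u|u v _ _ /val_inj//|x Xx]; first by rewrite /= in_setE.
by exists [` X_sub_U Xx]%fset => //=; rewrite in_setE.
Qed.

End FiniteSetFamily.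

(** * Chains and lattice paths *)

Definition idx_lt (d : nat) : rel (idx d) :=
  [rel i j : idx d | [forall l, (i l <= j l)%N] && (i != j)].

Lemma idx_lt_trans (d : nat) : transitive (@idx_lt d).
Proof.
move=> j i k /andP[/forallP ij nij] /andP[/forallP jk _]; apply/andP; split.
  by apply/forallP => l; exact: leq_trans (ij l) (jk l).
apply: contraNneq nij => ik; apply/eqP/ffunP => l; apply/eqP.
by rewrite eqn_leq ij ik jk.
Qed.

Lemma idx_lt_irr (d : nat) : irreflexive (@idx_lt d).
Proof. by move=> i; rewrite /idx_lt /= eqxx andbF. Qed.

Lemma step_idx_lt (d : nat) : subrel (@step d) (@idx_lt d).
Proof.
move=> i j /existsP[l /eqP ->]; apply/andP; split.
  by apply/forallP => k; rewrite ffunE leq_addr.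
apply/eqP => /(congr1 (@height d)); rewrite height_shift => /eqP.
by rewrite eq_sym eqn_leq ltnn.
Qed.

Lemma path_between (d : nat) (i j : idx d) : (forall l, (i l <= j l)%N) ->
  exists2 p, path (@step d) i p & last i p = j.
Proof.
move=> ij; have [p pp lp] := path_to [ffun l => (j l - i l)%N].
pose translate (k : idx d) : idx d := [ffun l => (i l + k l)%N].
have translate1 : translate (idx1 d) = i.
  by apply/ffunP => l; rewrite !ffunE addn0.
exists (map translate p); last first.
  rewrite -[in LHS]translate1 last_map lp.
  by apply/ffunP => l; rewrite !ffunE subnKC.
rewrite -translate1 path_map; apply: sub_path pp => k m /= /existsP[l /eqP ->].
by apply/existsP; exists l; apply/eqP/ffunP => q; rewrite !ffunE addnA.
Qed.

Lemma chain_sub_path (d : nat) (i : idx d) (s : seq (idx d)) :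
  path (@idx_lt d) i s ->
  exists2 p, path (@step d) i p & {subset s <= p}.
Proof.
elim: s i => [|j s IH] i /=; first by exists [::].
case/andP => /andP[/forallP ij nij] /IH[p pp sp].
have [[|k q] pq lq] := path_between ij; first by rewrite -lq eqxx in nij.
exists ((k :: q) ++ p); first by rewrite cat_path pq lq.
move=> m /predU1P[->|/sp mp]; rewrite mem_cat ?mp ?orbT// -lq.
by rewrite /= mem_last.
Qed.

Lemma chain_weight_le (d : nat) (A : array d) (s : seq (idx d)) :
  sorted (@idx_lt d) s -> (\sum_(i <- s) A i <= last_passage A)%N.
Proof.
have [_ ub] := last_passageP A.
case: s => [|i s] ss; first by rewrite big_nil.
have [p pp sp] := chain_sub_path ss; have [q pq lq] := path_to i.
have pqp : path (@step d) (idx1 d) (q ++ p) by rewrite cat_path pq lq.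
apply: leq_trans (ub _ _); last by exists (q ++ p).
apply: (@uniq_sub_le_big _ addn _ leqnn (fun m n => leq_addr n m)).
- exact: sorted_uniq (@idx_lt_trans d) (@idx_lt_irr d) _ ss.
- exact: step_path_uniq pqp.
- move=> j /predU1P[->|/sp jp]; rewrite -cat_cons mem_cat ?jp ?orbT//.
  by rewrite -lq mem_last.
Qed.

Lemma last_passage_le_embedding (d d' : nat) (A : array d) (B : array d')
    (h : idx d -> idx d') :
  {in finsupp A, forall i, A i = B (h i)} ->
  {in finsupp A &, {homo h : i j / idx_lt i j}} ->
  (last_passage A <= last_passage B)%N.
Proof.
move=> AB h_homo; have [[p pp ->] _] := last_passageP A.
have chain_p : sorted (@idx_lt d) (idx1 d :: p).
  exact: sub_path (@step_idx_lt d) _ _ pp.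
rewrite (bigID (mem (finsupp A))) /= [X in (_ + X)%N]big1 ?addn0; last first.
  by move=> i; rewrite memNfinsupp => /eqP.
rewrite (eq_bigr _ AB) -big_filter -(big_map h xpredT (fun i => B i)).
apply: chain_weight_le; rewrite sorted_map.
apply: (sub_in_sorted h_homo); first exact: filter_all.
exact: subseq_sorted (@idx_lt_trans d) _ _ (filter_subseq _ _) chain_p.
Qed.

(** * Partitions and arrays *)

Definition path_weights_from (d : nat) (A : array d) (i : idx d) : set nat :=
  [set w | exists2 p : seq (idx d),
             path (@step d) i p & w = (\sum_(j <- i :: p) A j)%N].

(* The default value 0 is never used, see last_passage_fromP. *)
Definition last_passage_from (d : nat) (A : array d) (i : idx d) : nat :=
  xget 0%N [set g | is_maximum (path_weights_from A i) g].

Lemma last_passage_from_idx1 (d : nat) (A : array d) :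
  last_passage_from A (idx1 d) = last_passage A.
Proof. by []. Qed.

Lemma last_passage_fromP (d : nat) (A : array d) (i : idx d) :
  is_maximum (path_weights_from A i) (last_passage_from A i).
Proof.
rewrite /last_passage_from; case: xgetP => [g _ //|no_max]; exfalso.
pose P w := `[< path_weights_from A i w >].
have exP : exists w, P w.
  by exists (\sum_(j <- [:: i]) A j)%N; apply/asboolP; exists [::].
have ubP w : P w -> (w <= last_passage A)%N.
  move=> /asboolP[p /(sub_path (@step_idx_lt d)) chain_p ->].
  exact: chain_weight_le.
case: (ex_maxnP exP ubP) => g /asboolP Pg gmax.
by apply: (no_max g); split=> // w Pw; apply: gmax; apply/asboolP.
Qed.

(* The maximum over an empty family of directions ([d = 0]) is [0]. *)
Definition max_shift (d : nat) (pi : idx d -> nat) (i : idx d) : nat :=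
  \max_(l < d) pi (shift i l).

Lemma leq_max_shift (d : nat) (pi : idx d -> nat) (i : idx d) (l : 'I_d) :
  (pi (shift i l) <= max_shift pi i)%N.
Proof. exact: (leq_bigmax (F := fun l => pi (shift i l))). Qed.

Definition passage_recurrence (d : nat) (A : array d) (pi : idx d -> nat) :
    Prop :=
  forall i, pi i = (A i + max_shift pi i)%N.

Lemma last_passage_from_recurrence (d : nat) (A : array d) :
  passage_recurrence A (last_passage_from A).
Proof.
move=> i; have [[p pp wp] ub] := last_passage_fromP A i.
apply/eqP; rewrite eqn_leq; apply/andP; split.
  rewrite wp big_cons leq_add2l; case: p pp {wp} => [|j p] /=.
    by rewrite big_nil.
  move=> /andP[/existsP[l /eqP ->] pp]; apply: leq_trans (leq_max_shift _ _ l).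
  by have [_] := last_passage_fromP A (shift i l); apply; exists p.
have extend q : path (@step d) i q ->
    (A i + \sum_(j <- q) A j <= last_passage_from A i)%N.
  by move=> pq; apply: ub; exists q; rewrite ?big_cons.
have A_le : (A i <= last_passage_from A i)%N.
  by have := extend [::] isT; rewrite big_nil addn0.
rewrite -leq_subRL//; apply/bigmax_leqP => l _.
have [[q pq ->] _] := last_passage_fromP A (shift i l); rewrite leq_subRL//.
by apply: extend; rewrite /= pq andbT; apply/existsP; exists l.
Qed.

Lemma passage_recurrence_partition (d : nat) (A pi : array d) :
  passage_recurrence A pi -> is_partition pi.
Proof.
move=> rec i l; rewrite [leqRHS]rec; apply: leq_trans (leq_addl _ _).
exact: leq_max_shift.
Qed.

Lemma height_bound (d : nat) (A : array d) :
  exists h, forall i : idx d, (h <= height i)%N -> A i = 0%N.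
Proof.
exists (\max_(i <- finsupp A) height i).+1 => i hi; apply/eqP.
rewrite -memNfinsupp; apply: contraTN hi => iA.
by rewrite -ltnNge ltnS; apply: leq_bigmax_seq.
Qed.

Lemma height_ind (d h : nat) (P : idx d -> Prop) :
  (forall i, (h <= height i)%N -> P i) ->
  (forall i, (forall l, P (shift i l)) -> P i) -> forall i, P i.
Proof.
move=> Pbig Pshift i; have [m] := ubnP (h - height i).
elim: m i => // m IH i; rewrite ltnS => hi.
have [/Pbig//|ih] := leqP h (height i).
apply: Pshift => l; apply: IH; rewrite height_shift.
by rewrite (leq_trans _ hi)// subnS prednK ?subn_gt0.
Qed.

Lemma passage_recurrence_inj (d : nat) (A pi pi' : array d) :
  passage_recurrence A pi -> passage_recurrence A pi' -> pi = pi'.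
Proof.
move=> rec rec'; apply/fsfunP.
have [h pi0] := height_bound pi; have [h' pi'0] := height_bound pi'.
apply: (@height_ind _ (maxn h h')) => i.
  by rewrite geq_max => /andP[/pi0 -> /pi'0 ->].
move=> IH; rewrite rec rec'; congr (_ + _)%N.
by apply: eq_bigr => l _; exact: IH.
Qed.

Definition increments (d : nat) (pi : array d) : array d :=
  [fsfun i in finsupp pi => (pi i - max_shift pi i)%N].

Lemma incrementsE (d : nat) (pi : array d) (i : idx d) :
  increments pi i = (pi i - max_shift pi i)%N.
Proof.
rewrite fsfunE; case: ifP => // /negbT.
by rewrite memNfinsupp => /eqP ->; rewrite sub0n.
Qed.

Lemma increments_recurrence (d : nat) (pi : array d) :
  is_partition pi -> passage_recurrence (increments pi) pi.
Proof.
move=> ppi i; rewrite incrementsE subnK//.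
by apply/bigmax_leqP => l _; exact: ppi.
Qed.

Definition box_supported (d : nat) (n : 'I_d -> nat) (A : array d) : Prop :=
  forall i, A i != 0%N -> in_box n i.

Lemma finite_in_box (d : nat) (n : 'I_d -> nat) : finite_set (@in_box d n).
Proof. exact: (finite_set_family (fun l => finite_II (n l))). Qed.

Lemma last_passage_from_outside (d : nat) (n : 'I_d -> nat) (A : array d)
    (i : idx d) :
  box_supported n A -> ~ in_box n i -> last_passage_from A i = 0%N.
Proof.
move=> A_box nin_i; have [[p pp ->] _] := last_passage_fromP A i.
rewrite big1_seq// => j /andP[_ jp]; apply/eqP.
apply: contra_notT nin_i => /A_box in_j l; apply: leq_ltn_trans (in_j l).
have /allP i_lt :=
  order_path_min (@idx_lt_trans d) (sub_path (@step_idx_lt d) pp).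
by move: jp => /predU1P[->//|/i_lt/andP[/forallP]].
Qed.

Definition bounding_box (d : nat) (A : array d) (l : 'I_d) : nat :=
  \max_(i <- finsupp A) (i l).+1.

Lemma bounding_box_supported (d : nat) (A : array d) :
  box_supported (bounding_box A) A.
Proof.
move=> i Ai l; rewrite /bounding_box.
apply: (leq_bigmax_seq (F := fun i : idx d => (i l).+1)) => //.
by rewrite mem_finsupp.
Qed.

Definition passage_times (d : nat) (A : array d) : array d :=
  [fsfun i in fset_set (in_box (bounding_box A)) => last_passage_from A i].

Lemma passage_timesE (d : nat) (A : array d) (i : idx d) :
  passage_times A i = last_passage_from A i.
Proof.
rewrite fsfunE in_fset_set; last exact: finite_in_box.
case: ifP => // /negbT; rewrite notin_setE => nin_i.
by rewrite (last_passage_from_outside (@bounding_box_supported d A)).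
Qed.

Lemma passage_times_recurrence (d : nat) (A : array d) :
  passage_recurrence A (passage_times A).
Proof.
move=> i; rewrite passage_timesE last_passage_from_recurrence; congr addn.
by apply: eq_bigr => l _; rewrite passage_timesE.
Qed.

Lemma passage_times_partition (d : nat) (A : array d) :
  is_partition (passage_times A).
Proof. exact/passage_recurrence_partition/passage_times_recurrence. Qed.

Lemma passage_timesK (d : nat) : cancel (@passage_times d) (@increments d).
Proof.
move=> A; apply/fsfunP => i.
by rewrite incrementsE passage_times_recurrence addnK.
Qed.

Lemma incrementsK (d : nat) (pi : array d) :
  is_partition pi -> passage_times (increments pi) = pi.
Proof.
move=> ppi; apply: passage_recurrence_inj.
  exact: passage_times_recurrence.
exact: increments_recurrence.
Qed.

Lemma increments_box (d : nat) (n : 'I_d -> nat) (pi : array d) :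
  box_supported n pi -> box_supported n (increments pi).
Proof.
move=> pi_box i; rewrite incrementsE => pi_i; apply: pi_box.
by apply: contraNneq pi_i => ->; rewrite sub0n.
Qed.

Lemma passage_times_box (d : nat) (n : 'I_d -> nat) (A : array d) :
  box_supported n A -> box_supported n (passage_times A).
Proof.
move=> A_box i; rewrite passage_timesE; apply: contra_neqP => nin_i.
exact: last_passage_from_outside nin_i.
Qed.

Lemma partition_le_idx1 (d : nat) (pi : array d) (i : idx d) :
  is_partition pi -> (pi i <= pi (idx1 d))%N.
Proof.
move=> ppi; have [p + <-] := path_to i.
elim/last_ind: p => //= p j IH; rewrite rcons_path last_rcons.
case/andP => /IH h /existsP[l /eqP ->]; exact: leq_trans (ppi _ _) h.
Qed.

Lemma partitionsP (d : nat) (n : 'I_d -> nat) (N : nat) (pi : array d) :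
  partitions n N pi <->
  [/\ is_partition pi, box_supported n pi & (pi (idx1 d) <= N)%N].
Proof.
split=> [[ppi in_diag]|[ppi pi_box leN]].
  split=> // [i|]; first by rewrite -lt0n -in_diagram => /in_diag[].
  case E : (pi (idx1 d)) => [//|k].
  by have /in_diag[] : (idx1 d, k) \in diagram pi by rewrite in_diagram E.
split=> // -[i k]; rewrite in_diagram /= => ki; split.
  by apply: pi_box; rewrite -lt0n (leq_ltn_trans _ ki).
exact: leq_trans ki (leq_trans (partition_le_idx1 i ppi) leN).
Qed.

Lemma increments_bij (d : nat) (n : 'I_d -> nat) (N : nat) :
  set_bij (partitions n N) (arrays_le n N) (@increments d).
Proof.
split=> [pi /partitionsP[ppi pi_box leN]|pi pi'|A [A_box leN]].
- split; first exact: increments_box.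
  by rewrite -last_passage_from_idx1 -passage_timesE incrementsK.
- rewrite !in_setE => -[ppi _] [ppi' _].
  by move=> /(congr1 (@passage_times d)); rewrite !incrementsK.
- exists (passage_times A); last exact: passage_timesK.
  apply/partitionsP; split; first exact: passage_times_partition.
    exact: passage_times_box.
  by rewrite passage_timesE last_passage_from_idx1.
Qed.

Lemma in_corners (d : nat) (pi : array d) (i : idx d) (k : nat) :
  ((i, k) \in corners pi) = (max_shift pi i <= k < pi i)%N.
Proof.
rewrite -in_diagram andbC in_fset inE /=; congr (_ && _).
apply/forallP/bigmax_leqP => h l; first by rewrite leqNgt -in_diagram.
by rewrite in_diagram -leqNgt; exact: h.
Qed.

Lemma prod_corners (R : comPzSemiRingType) (d : nat) (pi : array d)
    (F : idx d -> R) :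
  \prod_(c <- corners pi) F c.1 =
  \prod_(i <- finsupp (increments pi)) F i ^+ increments pi i.
Proof.
transitivity (\prod_(c <- [seq (i, k) | i <- finsupp pi,
                 k <- index_iota (max_shift pi i) (pi i)]) F c.1).
  apply: perm_big; apply: uniq_perm; first exact: fset_uniq.
    apply: allpairs_uniq_dep => [|i _|]; rewrite ?fset_uniq ?iota_uniq//.
    by move=> [i k] [j m] _ _ /= [-> ->].
  move=> [i k]; rewrite in_corners -mem_index_iota.
  apply/idP/allpairsPdep => [ik|[j [m [_ ? [-> ->]]]]//].
  exists i, k; split=> //; move: ik; rewrite mem_index_iota => /andP[_ ki].
  by rewrite mem_finsupp -lt0n (leq_ltn_trans _ ki).
rewrite big_allpairs_dep [RHS](@big_fset_incl _ _ _ _ _ (finsupp pi)).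
- by apply: eq_bigr => i _ /=; rewrite prodr_const_nat incrementsE.
- apply/fsubsetP => i; rewrite !mem_finsupp incrementsE.
  by apply: contraNneq => ->; rewrite sub0n.
- by move=> i _; rewrite memNfinsupp => /eqP ->.
Qed.

(** * Slice sums *)

Definition seq_monomial (R : pzSemiRingType) (y : nat -> R) (b : seq nat) : R :=
  \prod_(j < size b) y j ^+ nth 0%N b j.

Lemma prod_slices (R : comPzSemiRingType) (d : nat) (n : 'I_d -> nat)
    (A : array d) (l : 'I_d) (y : nat -> R) :
  box_supported n A ->
  \prod_(i <- finsupp A) y (i l) ^+ A i = seq_monomial y (slice_sums n A l).
Proof.
move=> A_box; rewrite /seq_monomial size_mkseq.
under [RHS]eq_bigr => j _ do rewrite nth_mkseq// -prodrXr big_mkcond.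
rewrite exchange_big /= big_seq [RHS]big_seq; apply: eq_bigr => i.
rewrite mem_finsupp => /A_box/(_ l) il; rewrite (bigD1 (Ordinal il))//= eqxx.
rewrite big1 ?mulr1// => j; rewrite eq_sym -val_eqE /= => /negPf ->//.
Qed.

Lemma sumn_slice_sums (d : nat) (n : 'I_d -> nat) (A : array d) (l : 'I_d) :
  box_supported n A -> sumn (slice_sums n A l) = (\sum_(i <- finsupp A) A i)%N.
Proof.
move=> A_box; rewrite sumnE big_map -{1}[n l]subn0 -/(index_iota 0 (n l)).
rewrite big_mkord.
rewrite /slice_sum (exchange_big_dep xpredT)//=; apply: eq_big_seq => i.
by rewrite mem_finsupp => /A_box/(_ l) il; rewrite (big_pred1 (Ordinal il)).
Qed.

Lemma slice_sum_neq0 (d : nat) (A : array d) (l : 'I_d) (i : idx d) :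
  A i != 0%N -> slice_sum A l (i l) != 0%N.
Proof.
move=> Ai; rewrite /slice_sum (big_rem i)/= ?mem_finsupp// eqxx.
by rewrite addn_eq0 negb_and Ai.
Qed.

Lemma nth_slice_sums (d : nat) (n : 'I_d -> nat) (A : array d) (l : 'I_d)
    (j : nat) :
  box_supported n A -> nth 0%N (slice_sums n A l) j = slice_sum A l j.
Proof.
move=> A_box; have [jn|nj] := ltnP j (n l); first by rewrite nth_mkseq.
rewrite nth_default ?size_mkseq// /slice_sum big_seq_cond big1// => i /andP[].
rewrite mem_finsupp => /A_box/(_ l) il /eqP ij.
by move: il; rewrite ij ltnNge nj.
Qed.

Definition slice_family (d : nat) (n : 'I_d -> nat) (A : array d) :
    {ffun 'I_d -> seq nat} := [ffun l => slice_sums n A l].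

Definition family_monomial (d : nat) (b : {ffun 'I_d -> seq nat}) :
    polyring d :=
  \prod_(l < d) seq_monomial (xvar l) (b l).

Lemma Fpoly_arrays (d : nat) (n : 'I_d -> nat) (N : nat) :
  Fpoly n N = \sum_(A \in arrays_le n N) family_monomial (slice_family n A).
Proof.
rewrite /Fpoly [RHS](reindex_fsbig _ _ _ _ (increments_bij n N)).
apply: eq_fsbigr => pi; rewrite in_setE => /partitionsP[_ /increments_box ? _].
rewrite (prod_corners pi (fun i => \prod_(l < d) xvar l (i l))).
under eq_bigr => i _ do rewrite -prodrXl.
rewrite exchange_big; apply: eq_bigr => l _.
by rewrite ffunE -prod_slices.
Qed.

(** * Sequences up to zero entries *)

Definition nonzeros (s : seq nat) : seq nat := [seq x <- s | x != 0%N].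

Definition positions (s : seq nat) : seq nat :=
  [seq j <- iota 0 (size s) | nth 0%N s j != 0%N].

Lemma nonzeros_composition (s : seq nat) : is_composition (nonzeros s).
Proof. by apply/allP => x; rewrite mem_filter /= lt0n => /andP[]. Qed.

Lemma sumn_nonzeros (s : seq nat) : sumn (nonzeros s) = sumn s.
Proof. by elim: s => //= x s IH; case: eqP => [->|_] /=; rewrite IH. Qed.

Lemma mem_positions (s : seq nat) (j : nat) :
  (j \in positions s) = (nth 0%N s j != 0%N).
Proof.
rewrite mem_filter mem_iota /= add0n; apply: andb_idr.
by apply: contraNT; rewrite -leqNgt => sj; rewrite nth_default.
Qed.

Lemma positions_lt_size (s : seq nat) : all (gtn (size s)) (positions s).
Proof. by apply/allP => j; rewrite mem_filter mem_iota => /andP[]. Qed.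

Lemma positions_sorted (s : seq nat) : sorted ltn (positions s).
Proof. by apply: sorted_filter; [exact: ltn_trans|exact: iota_ltn_sorted]. Qed.

Lemma map_positions (s : seq nat) : map (nth 0%N s) (positions s) = nonzeros s.
Proof.
by rewrite /positions /nonzeros -[in RHS](mkseq_nth 0%N s) /mkseq filter_map.
Qed.

Lemma size_positions (s : seq nat) : size (positions s) = size (nonzeros s).
Proof. by rewrite -map_positions size_map. Qed.

Lemma delete_trailing_zerosE (s : seq nat) :
  exists k, s = delete_trailing_zeros s ++ nseq k 0%N.
Proof.
rewrite /delete_trailing_zeros; set f := find _ _.
exists (size (take f (rev s))); rewrite -rev_nseq.
suff <- : take f (rev s) = nseq (size (take f (rev s))) 0%N.
  by rewrite -rev_cat cat_take_drop revK.
apply/all_pred1P/(all_nthP 0%N) => i.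
rewrite size_take_min leq_min => /andP[fi _].
by rewrite nth_take//= -[_ == _]negbK; apply/negbT; exact: before_find fi.
Qed.

Lemma delete_trailing_zeros_cat (a : seq nat) (k : nat) : is_composition a ->
  delete_trailing_zeros (a ++ nseq k 0%N) = a.
Proof.
move=> comp_a; rewrite /delete_trailing_zeros rev_cat rev_nseq.
elim: k => //=; case/lastP: a comp_a => [|a x] //.
rewrite /is_composition all_rcons => /andP[/= x0 _].
by rewrite rev_rcons /= -lt0n x0 drop0 rev_cons revK.
Qed.

Lemma no_internal_zero_cat (a : seq nat) (k : nat) : is_composition a ->
  no_internal_zero (a ++ nseq k 0%N).
Proof.
move=> /allP comp_a i j m /andP[_ jm] _; rewrite !nth_cat.
case: (ltnP m) => [ma _|am]; last by rewrite nth_nseq; case: ifP.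
have ja := ltn_trans jm ma; rewrite ja.
by apply: comp_a; rewrite mem_nth.
Qed.

Lemma nonzeros_cat_nseq0 (a : seq nat) (k : nat) : is_composition a ->
  nonzeros (a ++ nseq k 0%N) = a.
Proof.
move=> comp_a; rewrite /nonzeros filter_cat filter_nseq /= cats0.
by apply/all_filterP; apply: sub_all comp_a => x /=; rewrite lt0n.
Qed.

Definition relabel (T : eqType) (s t : seq T) (x : T) : T :=
  nth x t (index x s).

Section Relabel.
Variables (T : eqType) (s t : seq T).
Hypothesis eq_size : size s = size t.

Lemma relabel_mem : {in s, forall x, relabel s t x \in t}.
Proof. by move=> x xs; rewrite mem_nth// -eq_size index_mem. Qed.

Lemma relabelK : uniq t -> {in s, cancel (relabel s t) (relabel t s)}.
Proof.
move=> uniq_t x xs; rewrite {1}/relabel index_uniq -?eq_size ?index_mem//.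
by rewrite (set_nth_default x) ?nth_index// index_mem.
Qed.

Lemma relabel_homo (r : rel T) :
  transitive r -> irreflexive r -> sorted r s -> sorted r t ->
  {in s &, {homo relabel s t : x y / r x y}}.
Proof.
move=> r_trans r_irr sorted_s sorted_t x y xs ys rxy.
have lt_xy : (index x s < index y s)%N.
  rewrite ltnNge; apply/negP; rewrite leq_eqVlt => /predU1P[|].
    by move=> /(index_inj x ys xs) yx; rewrite yx r_irr in rxy.
  move=> /(sorted_ltn_index r_trans sorted_s _ _ ys xs)/(r_trans _ _ _ rxy).
  by rewrite r_irr.
have y_lt : (index y s < size t)%N by rewrite -eq_size index_mem.
rewrite /relabel (set_nth_default x y y_lt).
by apply: (sorted_ltn_nth r_trans) => //; rewrite inE (ltn_trans lt_xy).
Qed.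

End Relabel.

Lemma nth_relabel_positions (s t : seq nat) : nonzeros s = nonzeros t ->
  {in positions s, forall j,
     nth 0%N t (relabel (positions s) (positions t) j) = nth 0%N s j}.
Proof.
move=> eq_st j js.
have j_lt : (index j (positions s) < size (positions s))%N by rewrite index_mem.
have eq_size : size (positions s) = size (positions t).
  by rewrite !size_positions eq_st.
rewrite /relabel -(nth_map j 0%N (nth 0%N t)) -?eq_size//.
by rewrite map_positions -eq_st -map_positions (nth_map j)// nth_index.
Qed.

(** * Moving arrays between grids *)

Definition on_grid (d : nat) (P : 'I_d -> seq nat) : pred (idx d) :=
  [pred i : idx d | [forall l, i l \in P l]].

Definition grid_supported (d : nat) (P : 'I_d -> seq nat) (A : array d) :
    Prop :=
  {subset finsupp A <= on_grid P}.

(* Then [relabel (P l) (Q l)] is the order isomorphism from [P l] to [Q l]. *)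
Definition similar_grids (d : nat) (P Q : 'I_d -> seq nat) : Prop :=
  forall l, [/\ sorted ltn (P l), sorted ltn (Q l) & size (P l) = size (Q l)].

Lemma similar_grids_sym (d : nat) (P Q : 'I_d -> seq nat) :
  similar_grids P Q -> similar_grids Q P.
Proof. by move=> PQ l; have [] := PQ l. Qed.

Definition relabel_idx (d : nat) (P Q : 'I_d -> seq nat) (i : idx d) : idx d :=
  [ffun l => relabel (P l) (Q l) (i l)].

Section RelabelIdx.
Variables (d : nat) (P Q : 'I_d -> seq nat).
Hypothesis PQ : similar_grids P Q.

Lemma relabel_idx_on_grid :
  {homo relabel_idx P Q : i / i \in on_grid P >-> i \in on_grid Q}.
Proof.
move=> i /forallP Pi; apply/forallP => l; have [_ _ eq_size] := PQ l.
by rewrite ffunE relabel_mem.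
Qed.

Lemma relabel_idxK : {in on_grid P, cancel (relabel_idx P Q) (relabel_idx Q P)}.
Proof.
move=> i /forallP Pi; apply/ffunP => l; have [_ sQ eq_size] := PQ l.
by rewrite !ffunE relabelK//; exact: sorted_uniq ltn_trans ltnn _ sQ.
Qed.

Lemma relabel_idx_homo :
  {in on_grid P &, {homo relabel_idx P Q : i j / idx_lt i j}}.
Proof.
move=> i j Pi Pj /andP[/forallP ij nij]; apply/andP; split.
  apply/forallP => l; rewrite !ffunE; have [sP sQ eq_size] := PQ l.
  have homo_lt := relabel_homo eq_size ltn_trans ltnn sP sQ.
  by apply: (ltnW_homo_in homo_lt); rewrite ?(forallP Pi) ?(forallP Pj).
apply: contraNneq nij => /(congr1 (relabel_idx Q P)).
by rewrite !relabel_idxK// => ->.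
Qed.

End RelabelIdx.

Definition relabel_array (d : nat) (P Q : 'I_d -> seq nat) (A : array d) :
    array d :=
  [fsfun i in [fset relabel_idx P Q j | j in finsupp A]%fset =>
     A (relabel_idx Q P i)].

Section RelabelArray.
Variables (d : nat) (P Q : 'I_d -> seq nat) (A : array d).
Hypotheses (PQ : similar_grids P Q) (A_on_P : grid_supported P A).

Let QP := similar_grids_sym PQ.

Lemma relabel_arrayE i :
  relabel_array P Q A i =
  if i \in on_grid Q then A (relabel_idx Q P i) else 0%N.
Proof.
rewrite fsfunE; case: imfsetP => [[j /= /A_on_P Pj ->]|not_image].
  by rewrite relabel_idx_on_grid.
case: ifP => // Qi; apply/esym/eqP; apply: contra_notT not_image => Ai.
by exists (relabel_idx Q P i); rewrite ?mem_finsupp// relabel_idxK.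
Qed.

Lemma relabel_array_on_grid : grid_supported Q (relabel_array P Q A).
Proof. by move=> i; rewrite mem_finsupp relabel_arrayE; case: ifP. Qed.

Lemma finsupp_relabel_array :
  finsupp (relabel_array P Q A) =
  [fset relabel_idx P Q i | i in finsupp A]%fset.
Proof.
apply/fsetP => i; rewrite mem_finsupp relabel_arrayE.
apply/idP/imfsetP => [|[k /= kA ->]].
  case: ifP => // Qi Ai; exists (relabel_idx Q P i); rewrite ?mem_finsupp//.
  by rewrite relabel_idxK.
by rewrite relabel_idx_on_grid ?relabel_idxK -?mem_finsupp//; exact: A_on_P.
Qed.

Lemma relabel_array_last_passage_le :
  (last_passage (relabel_array P Q A) <= last_passage A)%N.
Proof.
apply: (@last_passage_le_embedding _ _ _ _ (relabel_idx Q P)) => [i|i j].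
  by move=> /relabel_array_on_grid Qi; rewrite relabel_arrayE Qi.
move=> /relabel_array_on_grid Qi /relabel_array_on_grid Qj.
exact: relabel_idx_homo QP _ _ Qi Qj.
Qed.

Lemma relabel_array_slice_sum l j : j \in Q l ->
  slice_sum (relabel_array P Q A) l j = slice_sum A l (relabel (Q l) (P l) j).
Proof.
move=> Qj; have [sP sQ eq_size] := PQ l.
rewrite /slice_sum finsupp_relabel_array big_mkcond big_imfset /=; last first.
  by move=> i k /A_on_P Pi /A_on_P Pk; exact: (can_in_inj (relabel_idxK PQ)).
rewrite -big_mkcond big_seq_cond [RHS]big_seq_cond.
apply: eq_big => [i|i /andP[/A_on_P Pi _]]; last first.
  by rewrite relabel_arrayE relabel_idx_on_grid// relabel_idxK.
apply: andb_id2l => /A_on_P/forallP/(_ l) Pi; rewrite ffunE.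
by apply/eqP/eqP => [<-|->]; rewrite relabelK// (sorted_uniq ltn_trans ltnn).
Qed.

End RelabelArray.

Lemma relabel_arrayK (d : nat) (P Q : 'I_d -> seq nat) (A : array d) :
  similar_grids P Q -> grid_supported P A ->
  relabel_array Q P (relabel_array P Q A) = A.
Proof.
move=> PQ A_on_P; have QP := similar_grids_sym PQ; apply/fsfunP => i.
rewrite relabel_arrayE//; last exact: relabel_array_on_grid.
case: ifPn => [Pi|nPi].
  by rewrite relabel_arrayE// relabel_idx_on_grid// relabel_idxK.
by apply/esym/eqP; rewrite -memNfinsupp; apply: contra nPi => /A_on_P.
Qed.

Lemma slice_sum_off_grid (d : nat) (P : 'I_d -> seq nat) (A : array d)
    (l : 'I_d) (j : nat) :
  grid_supported P A -> j \notin P l -> slice_sum A l j = 0%N.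
Proof.
move=> A_on_P; apply: contraNeq; apply: contraR => Pj; apply/eqP.
rewrite /slice_sum big_seq_cond big1// => i /andP[/A_on_P/forallP/(_ l)].
by move=> /[swap] /eqP -> /(negP Pj).
Qed.

(** * Arrays with given slice sums *)

Definition same_nonzeros (d : nat) (b c : {ffun 'I_d -> seq nat}) : Prop :=
  forall l, nonzeros (b l) = nonzeros (c l).

Definition positions_grid (d : nat) (b : {ffun 'I_d -> seq nat}) (l : 'I_d) :
    seq nat :=
  positions (b l).

Lemma similar_positions_grids (d : nat) (b c : {ffun 'I_d -> seq nat}) :
  same_nonzeros b c -> similar_grids (positions_grid b) (positions_grid c).
Proof.
by move=> bc l; split; rewrite ?positions_sorted ?size_positions ?bc.
Qed.

Definition arrays_with_slices (d : nat) (n : 'I_d -> nat) (N : nat)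
    (b : {ffun 'I_d -> seq nat}) : set (array d) :=
  [set A | arrays_le n N A /\ slice_family n A = b].

Section ArraysWithSlices.
Variables (d : nat) (n : 'I_d -> nat) (N : nat).
Implicit Types (b c : {ffun 'I_d -> seq nat}) (A : array d).

Definition move_slices b c A : array d :=
  relabel_array (positions_grid b) (positions_grid c) A.

Lemma finite_arrays_with_slices b : finite_set (arrays_with_slices n N b).
Proof. by apply: sub_finite_set (finite_arrays_le n N) => A []. Qed.

Lemma slice_family_on_grid A :
  box_supported n A -> grid_supported (positions_grid (slice_family n A)) A.
Proof.
move=> A_box i; rewrite mem_finsupp => Ai; apply/forallP => l.
by rewrite mem_positions ffunE nth_slice_sums// slice_sum_neq0.
Qed.

Lemma arrays_with_slices_on_grid b A :
  arrays_with_slices n N b A -> grid_supported (positions_grid b) A.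
Proof. by move=> [[A_box _] <-]; exact: slice_family_on_grid. Qed.

Lemma slice_family_move_slices c A :
  box_supported n A -> same_nonzeros (slice_family n A) c ->
  (forall l, size (c l) = n l) ->
  slice_family n (move_slices (slice_family n A) c A) = c.
Proof.
move=> A_box Ac size_c; have grids := similar_positions_grids Ac.
have A_grid := slice_family_on_grid A_box; apply/ffunP => l; rewrite ffunE.
apply: (@eq_from_nth _ 0%N) => [|j]; rewrite size_mkseq ?size_c// => jn.
rewrite nth_mkseq//.
have [jc|jc] := boolP (j \in positions_grid c l); last first.
  rewrite (slice_sum_off_grid (relabel_array_on_grid grids A_grid))//.
  by move: jc; rewrite mem_positions negbK => /eqP.
rewrite relabel_array_slice_sum// -(nth_slice_sums _ _ A_box).
rewrite -[slice_sums n A l](ffunE (slice_sums n A)).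
by rewrite nth_relabel_positions// Ac.
Qed.

Lemma move_slices_with_slices b c A :
  same_nonzeros b c -> (forall l, size (c l) = n l) ->
  arrays_with_slices n N b A -> arrays_with_slices n N c (move_slices b c A).
Proof.
move=> bc size_c Ab; have [[A_box leN] slices_A] := Ab.
have grids := similar_positions_grids bc.
have A_grid := arrays_with_slices_on_grid Ab.
split; last by rewrite -slices_A slice_family_move_slices// slices_A.
split=> [i|]; last first.
  exact: leq_trans (relabel_array_last_passage_le grids A_grid) leN.
rewrite -mem_finsupp => /(relabel_array_on_grid grids A_grid)/forallP ic l.
by rewrite -size_c; exact: (allP (positions_lt_size _)) (ic l).
Qed.

Lemma move_slicesK b c A :
  same_nonzeros b c -> arrays_with_slices n N b A ->
  move_slices c b (move_slices b c A) = A.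
Proof.
move=> bc /arrays_with_slices_on_grid A_grid.
by apply: relabel_arrayK A_grid; exact: similar_positions_grids.
Qed.

Lemma card_arrays_with_slices b c :
  same_nonzeros b c ->
  (forall l, size (b l) = n l) -> (forall l, size (c l) = n l) ->
  #|` fset_set (arrays_with_slices n N b)| =
  #|` fset_set (arrays_with_slices n N c)|.
Proof.
move=> bc size_b size_c; have cb : same_nonzeros c b by move=> l; rewrite bc.
have image_b :
    move_slices b c @` arrays_with_slices n N b = arrays_with_slices n N c.
  apply/seteqP; split=> [_ [A Ab <-]|A Ac].
    exact: move_slices_with_slices.
  exists (move_slices c b A); first exact: move_slices_with_slices.
  exact: move_slicesK.
apply/fcard_eq; [exact: finite_arrays_with_slices..|].
rewrite -image_b card_eq_sym; apply: inj_card_eq => A B; rewrite !in_setE.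
by move=> Ab Bb /(congr1 (move_slices c b)); rewrite !move_slicesK.
Qed.

End ArraysWithSlices.

Definition pad (d : nat) (n : 'I_d -> nat) (alpha : {ffun 'I_d -> seq nat}) :
    {ffun 'I_d -> seq nat} :=
  [ffun l => alpha l ++ nseq (n l - size (alpha l)) 0%N].

Lemma packed_arraysE (d : nat) (n : 'I_d -> nat) (N : nat)
    (alpha : {ffun 'I_d -> seq nat}) :
  (forall l, is_composition (alpha l)) ->
  packed_arrays n N alpha = arrays_with_slices n N (pad n alpha).
Proof.
move=> comp_alpha; apply/seteqP.
split=> [A [A_le _ A_slices]|A [A_le /ffunP A_slices]].
  split=> //; apply/ffunP => l; rewrite !ffunE.
  have [k slicesE] := delete_trailing_zerosE (slice_sums n A l).
  rewrite A_slices in slicesE; rewrite slicesE; congr (_ ++ nseq _ _).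
  have := congr1 size slicesE; rewrite size_mkseq size_cat size_nseq => ->.
  by rewrite addKn.
split=> // l; have := A_slices l; rewrite !ffunE => ->.
  exact: no_internal_zero_cat.
exact: delete_trailing_zeros_cat.
Qed.

(** * Monomial quasisymmetric functions *)

Definition zero_insertions (a : seq nat) (n : nat) : set (seq nat) :=
  [set b | size b = n /\ nonzeros b = a].

Definition zero_insertion_families (d : nat) (n : 'I_d -> nat)
    (alpha : {ffun 'I_d -> seq nat}) : set {ffun 'I_d -> seq nat} :=
  set_family (fun l => zero_insertions (alpha l) (n l)).

Lemma mcoefE (d : nat) (n : 'I_d -> nat) (N : nat)
    (alpha b : {ffun 'I_d -> seq nat}) :
  zero_insertion_families n alpha b ->
  mcoef n N alpha = #|` fset_set (arrays_with_slices n N b)|.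
Proof.
move=> b_alpha; have comp_alpha l : is_composition (alpha l).
  by have [_ <-] := b_alpha l; exact: nonzeros_composition.
rewrite /mcoef packed_arraysE//.
apply: card_arrays_with_slices => l; rewrite ?ffunE.
- by have [_ ->] := b_alpha l; rewrite nonzeros_cat_nseq0.
- rewrite size_cat size_nseq subnKC//; have [<- <-] := b_alpha l.
  by rewrite size_filter count_size.
- by have [] := b_alpha l.
Qed.

Definition increasing_seqs (k n : nat) : set (seq nat) :=
  [set t | [/\ size t = k, sorted ltn t & all (gtn n) t]].

(* Meant for [size t = size a]: the entries outside [t] are then the default [0]
   of [nth]. *)
Definition spread (a : seq nat) (n : nat) (t : seq nat) : seq nat :=
  mkseq (fun j => nth 0%N a (index j t)) n.

Lemma positions_spread (a : seq nat) (n : nat) (t : seq nat) :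
  is_composition a -> increasing_seqs (size a) n t ->
  positions (spread a n t) = t.
Proof.
move=> /allP comp_a [size_t sorted_t /allP t_lt].
apply: (irr_sorted_eq ltn_trans ltnn) => //; first exact: positions_sorted.
move=> j; rewrite mem_positions; have [jn|nj] := ltnP j n; last first.
  rewrite nth_default ?size_mkseq//=; apply/esym/negbTE.
  by apply: contraL nj => /t_lt; rewrite -ltnNge.
rewrite nth_mkseq//; apply/idP/idP.
  by apply: contraNT => jt; rewrite nth_default// -size_t memNindex.
by move=> jt; rewrite -lt0n; apply: comp_a; rewrite mem_nth// -size_t index_mem.
Qed.

Lemma nonzeros_spread (a : seq nat) (n : nat) (t : seq nat) :
  is_composition a -> increasing_seqs (size a) n t ->
  nonzeros (spread a n t) = a.
Proof.
move=> comp_a t_inc; have [size_t sorted_t /allP t_lt] := t_inc.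
rewrite -map_positions positions_spread//.
apply: (@eq_from_nth _ 0%N) => [|j]; rewrite size_map// => jt.
have uniq_t : uniq t by exact: sorted_uniq ltn_trans ltnn _ sorted_t.
rewrite (nth_map 0%N)// nth_mkseq ?index_uniq//.
by apply: t_lt; rewrite mem_nth.
Qed.

Lemma spread_positions (b : seq nat) :
  spread (nonzeros b) (size b) (positions b) = b.
Proof.
apply: (@eq_from_nth _ 0%N) => [|j]; rewrite size_mkseq// => jb.
rewrite nth_mkseq// -map_positions.
have [jp|jp] := boolP (j \in positions b).
  by rewrite (nth_map 0%N) ?index_mem// nth_index.
rewrite nth_default ?size_map ?memNindex//.
by move: jp; rewrite mem_positions negbK => /eqP.
Qed.

Lemma spread_bij (a : seq nat) (n : nat) : is_composition a ->
  set_bij (increasing_seqs (size a) n) (zero_insertions a n) (spread a n).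
Proof.
move=> comp_a; split=> [t t_inc|t u|b [<- <-]].
- by split; [rewrite size_mkseq|exact: nonzeros_spread].
- rewrite !in_setE => t_inc u_inc /(congr1 positions).
  by rewrite !positions_spread.
- exists (positions b); last exact: spread_positions.
  by split; rewrite ?size_positions ?positions_sorted ?positions_lt_size.
Qed.

Definition increasing (k n : nat) (f : {ffun 'I_k -> 'I_n}) : bool :=
  [forall p : 'I_k, forall q : 'I_k, (p < q)%N ==> (f p < f q)%N].

Definition values (k n : nat) (f : {ffun 'I_k -> 'I_n}) : seq nat :=
  [seq val (f p) | p <- enum 'I_k].

Lemma nth_values (k n : nat) (f : {ffun 'I_k -> 'I_n}) (p : 'I_k) :
  nth 0%N (values f) p = f p.
Proof. by rewrite (nth_map p) ?size_enum_ord// nth_ord_enum. Qed.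

Lemma size_values (k n : nat) (f : {ffun 'I_k -> 'I_n}) : size (values f) = k.
Proof. by rewrite size_map size_enum_ord. Qed.

Lemma values_bij (k n : nat) :
  set_bij [set` @increasing k n] (increasing_seqs k n) (@values k n).
Proof.
split=> [f /forallP incf|f g _ _ fg|t [size_t sorted_t /allP t_lt]].
- split; first exact: size_values.
    rewrite sorted_map; have /sub_sorted : subrel (relpre val ltn)
      (relpre (fun p => val (f p)) ltn).
      by move=> p q /= pq; move/forallP/(_ q)/implyP: (incf p); apply.
    by apply; rewrite -sorted_map val_enum_ord iota_ltn_sorted.
  by apply/allP => j /mapP[p _ ->] /=.
- by apply/ffunP => p; apply: val_inj; rewrite /= -!nth_values fg.
have nth_lt (p : 'I_k) : (nth 0 t p < n)%N.
  by apply: t_lt; rewrite mem_nth// size_t.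
exists [ffun p => Ordinal (nth_lt p)].
  apply/forallP => p; apply/forallP => q; apply/implyP => pq; rewrite !ffunE /=.
  by apply: (sorted_ltn_nth ltn_trans) pq => //; rewrite inE size_t.
apply: (@eq_from_nth _ 0%N) => [|j]; rewrite size_values ?size_t// => jk.
by rewrite (nth_values _ (Ordinal jk)) ffunE.
Qed.

Lemma finite_zero_insertions (a : seq nat) (n : nat) :
  is_composition a -> finite_set (zero_insertions a n).
Proof.
move=> /spread_bij-/(_ n)[_ _ spread_surj].
have [_ _ values_surj] := values_bij (size a) n.
apply: sub_finite_set spread_surj (finite_image _ _).
exact: sub_finite_set values_surj (finite_image _ finite_finset).
Qed.

Lemma seq_monomial_positions (R : comPzSemiRingType) (y : nat -> R)
    (b : seq nat) :
  seq_monomial y b = \prod_(j <- positions b) y j ^+ nth 0%N b j.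
Proof.
rewrite /seq_monomial big_filter [RHS]big_mkcond /=.
rewrite -(big_mkord xpredT (fun j => y j ^+ nth 0%N b j)) /index_iota subn0.
by apply: eq_bigr => j _; case: eqP => [->|].
Qed.

Lemma seq_monomial_spread (R : comPzSemiRingType) (y : nat -> R) (a : seq nat)
    (n : nat) (t : seq nat) :
  is_composition a -> increasing_seqs (size a) n t ->
  seq_monomial y (spread a n t) =
  \prod_(p < size a) y (nth 0%N t p) ^+ nth 0%N a p.
Proof.
move=> comp_a t_inc; have [size_t sorted_t /allP t_lt] := t_inc.
have uniq_t : uniq t by exact: sorted_uniq ltn_trans ltnn _ sorted_t.
rewrite seq_monomial_positions positions_spread// (big_nth 0%N) size_t.
rewrite big_mkord.
apply: eq_bigr => p _; have pt : (p < size t)%N by rewrite size_t.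
by rewrite nth_mkseq ?index_uniq//; apply: t_lt; rewrite mem_nth.
Qed.

Lemma monomial_qsymE (R : comNzRingType) (a : seq nat) (n : nat)
    (y : nat -> R) :
  is_composition a ->
  monomial_qsym a n y = \sum_(b \in zero_insertions a n) seq_monomial y b.
Proof.
move=> comp_a; rewrite (reindex_fsbig _ _ _ _ (spread_bij n comp_a)).
rewrite (reindex_fsbig _ _ _ _ (values_bij (size a) n)) -fsbig_fin.
apply: eq_bigr => f incf; rewrite seq_monomial_spread//; last first.
  by have [values_inc _ _] := values_bij (size a) n; exact: values_inc.
by apply: eq_bigr => p _; rewrite nth_values.
Qed.

(** * The expansion *)

Definition slice_compositions (d : nat) (n : 'I_d -> nat) (A : array d) :
    {ffun 'I_d -> seq nat} := [ffun l => nonzeros (slice_sums n A l)].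

Lemma slice_compositions_family (d : nat) (n : 'I_d -> nat) (A : array d) :
  box_supported n A -> composition_families d (slice_compositions n A).
Proof.
move=> A_box; split=> [l|k l]; rewrite !ffunE.
  exact: nonzeros_composition.
by rewrite !sumn_nonzeros !sumn_slice_sums.
Qed.

Lemma slice_compositionsP (d : nat) (n : 'I_d -> nat) (A : array d)
    (alpha : {ffun 'I_d -> seq nat}) :
  slice_compositions n A = alpha <->
  zero_insertion_families n alpha (slice_family n A).
Proof.
split=> [<- l|A_alpha]; first by split; rewrite !ffunE ?size_mkseq.
by apply/ffunP => l; have [_] := A_alpha l; rewrite !ffunE.
Qed.

Lemma sum_arrays_with_slices (d : nat) (n : 'I_d -> nat) (N : nat)
    (alpha b : {ffun 'I_d -> seq nat}) :
  zero_insertion_families n alpha b ->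
  \sum_(A \in arrays_with_slices n N b) family_monomial (slice_family n A) =
  (mcoef n N alpha)%:R * family_monomial b.
Proof.
move=> b_alpha; rewrite (mcoefE N b_alpha) mulr_natl -sum_fsbig_const.
  by apply: eq_fsbigr => A; rewrite in_setE => -[_ ->].
exact: finite_arrays_with_slices.
Qed.

Lemma prod_monomial_qsym (d : nat) (n : 'I_d -> nat)
    (alpha : {ffun 'I_d -> seq nat}) :
  (forall l, is_composition (alpha l)) ->
  \prod_(l < d) monomial_qsym (alpha l) (n l) (xvar l) =
  \sum_(b \in zero_insertion_families n alpha) family_monomial b.
Proof.
move=> comp_alpha; under eq_bigr => l _ do rewrite monomial_qsymE//.
by apply: bigA_distr_fsbig => l; exact: finite_zero_insertions.
Qed.

Lemma sum_slice_compositions (d : nat) (n : 'I_d -> nat) (N : nat)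
    (alpha : {ffun 'I_d -> seq nat}) :
  (forall l, is_composition (alpha l)) ->
  \sum_(A \in arrays_le n N `&` slice_compositions n @^-1` [set alpha])
     family_monomial (slice_family n A) =
  (mcoef n N alpha)%:R * \prod_(l < d) monomial_qsym (alpha l) (n l) (xvar l).
Proof.
move=> comp_alpha.
have fin_insertions l := finite_zero_insertions (n l) (comp_alpha l).
rewrite prod_monomial_qsym// fsbig_distrr; last first.
  exact: finite_set_family fin_insertions.
rewrite (partition_fsbig (slice_family n) (zero_insertion_families n alpha)).
- apply: eq_fsbigr => b; rewrite in_setE => b_alpha.
  apply: etrans (sum_arrays_with_slices N b_alpha).
  apply: eq_fsbigl; apply/seteqP; split=> [A [[A_le _] Ab]//|A [A_le Ab]].
  by split=> //; split=> //; apply/slice_compositionsP; rewrite Ab.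
- exact/finite_setIl/finite_arrays_le.
- by move=> _ [A [_ /slice_compositionsP A_alpha] <-].
Qed.

Theorem theorem6p12 (d : nat) (n : 'I_d -> nat) (N : nat)
    (n_gt0 : forall l, (0 < n l)%N) (N_gt0 : (0 < N)%N) :
  Fpoly n N =
  \sum_(alpha \in composition_families d)
    (mcoef n N alpha)%:R *
    \prod_(l < d) monomial_qsym (alpha l) (n l) (xvar l).
Proof.
rewrite Fpoly_arrays.
rewrite (partition_fsbig (slice_compositions n) (composition_families d)).
- apply: eq_fsbigr => alpha; rewrite in_setE => -[comp_alpha _].
  exact: sum_slice_compositions.
- exact: finite_arrays_le.
- by move=> _ [A [A_box _] <-]; exact: slice_compositions_family.
Qed.
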